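(* Let $\mathbb{F}$ be an arbitrary field, let $n\geq 3$ and let $k$ be an integer with $2\leq k\leq n-1$. Let $\mathcal{L}_1,\ldots,\mathcal{L}_{n-k}$ be finite families of lines in $\mathbb{F}^n$ and let $\mathcal{P}$ be a finite family of $k$-planes in $\mathbb{F}^n$. Let $J$ be the set of multijoints formed by these collections, and set \[ L:=\max\{|\mathcal{L}_1|,\ldots,|\mathcal{L}_{n-k}|\},\qquad d:=n-k+1 . \] Then \[ |J|\leq C_n\, L\, |\mathcal{P}|^{\frac{1}{d-1}}, \] where $C_n$ is a constant depending only on $n$ (in particular independent of the field $\mathbb{F}$ and of the families).
   Context: A $k$-plane in $\mathbb{F}^n$ is an affine subspace of dimension $k$, i.e. a set $x_0+V$ with $V$ a $k$-dimensional linear subspace of $\mathbb{F}^n$ (the linear subspace parallel to the plane). A line is a $1$-plane. A multijoint for the collections $\mathcal{L}_1,\ldots,\mathcal{L}_{n-k},\mathcal{P}$ is a point $x\in\mathbb{F}^n$ such that there exist lines $l_i\in\mathcal{L}_i$ ($i=1,\ldots,n-k$) and a $k$-plane $P\in\mathcal{P}$, all containing $x$, such that the direction vectors of $l_1,\ldots,l_{n-k}$ together with a spanning set of the linear subspace parallel to $P$ span $\mathbb{F}^n$. The number $d$ is the total number of collections. *)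

(* Defs.v *)
From HB Require Import structures.
From mathcomp Require Import all_boot all_order all_algebra.
From mathcomp Require Import finmap.
From mathcomp Require Import all_classical all_reals all_analysis.

Set Implicit Arguments.
Unset Strict Implicit.
Unset Printing Implicit Defensive.

Local Open Scope classical_set_scope.
Local Open Scope ring_scope.

Section Planes.
Variables (F : fieldType) (n : nat).

Definition parallel_to (A : set 'rV[F]_n) (V : {vspace 'rV[F]_n}) : Prop :=
  exists x0 : 'rV[F]_n, A = [set x0 + v | v in [set v | v \in V]].

Definition is_plane (k : nat) (A : set 'rV[F]_n) : Prop :=
  exists2 V : {vspace 'rV[F]_n}, \dim V = k & parallel_to A V.

Definition is_line (A : set 'rV[F]_n) : Prop := is_plane 1 A.

Definition is_direction (A : set 'rV[F]_n) (v : 'rV[F]_n) : Prop :=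
  v != 0 /\ parallel_to A <[v]>%VS.

(* For a family Ps of k-planes, the intended value of m is n - k. *)
Definition is_multijoint (m : nat) (Ls : 'I_m -> {fset (set 'rV[F]_n)})
    (Ps : {fset (set 'rV[F]_n)}) (x : 'rV[F]_n) : Prop :=
  exists (l : 'I_m -> set 'rV[F]_n) (P : set 'rV[F]_n),
    [/\ forall i, l i \in Ls i /\ l i x,
        P \in Ps /\ P x &
        exists (v : 'I_m -> 'rV[F]_n) (W : {vspace 'rV[F]_n}),
          [/\ forall i, is_direction (l i) (v i),
              parallel_to P W &
              (<<[seq v i | i <- enum 'I_m]>> + W)%VS = fullv]].

Definition multijoints (m : nat) (Ls : 'I_m -> {fset (set 'rV[F]_n)})
    (Ps : {fset (set 'rV[F]_n)}) : set 'rV[F]_n :=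
  [set x | is_multijoint Ls Ps x].

End Planes.

(* Main.v *)
(** Let [D] be of the order of [|P|^(1/(n-k))]. Counting coefficients gives a
    nonzero polynomial [g] of degree at most [D] vanishing on every plane of the
    family. It then suffices to see that some line contains at most [D]
    multijoints: removing that line together with its multijoints and iterating,
    the number of multijoints is at most [D] times the number of lines.

    Suppose that every line contains more than [D] of the multijoints, and that
    [g] vanishes to order [e] at all of them. Expand [g] at a multijoint [x] in
    coordinates [t] along its lines and [u] along its plane. A coefficient of
    degree [e] purely in [u] is zero because [g] vanishes on the plane.
    Otherwise the monomial contains some [t_j]; deleting the power of [t_j]
    leaves a monomial of degree less than [e], whose coefficient along the
    [j]-th line is a univariate polynomial of degree at most [D] with a zero at
    each multijoint of that line, hence zero. So [g] vanishes to order [e + 1]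
    at all multijoints, for every [e], which is impossible. Working with
    coefficients rather than derivatives makes this valid in any
    characteristic. *)

Require Import Defs.
From HB Require Import structures.
From mathcomp Require Import all_boot all_order all_algebra.
From mathcomp Require mpoly.

Set Implicit Arguments.
Unset Strict Implicit.
Unset Printing Implicit Defensive.

Import Order.TTheory GRing.Theory Num.Theory.
Local Open Scope ring_scope.

(** * Affine substitution in multivariate polynomials *)

Section AffineSubstitution.

Import mpoly.

(** Pullback of [p] along the affine map sending [y] to [x + y *m A]. For [A = 1%:M] its
    coefficients are those of the expansion of [p] at [x]. *)
Definition aff_mpoly (F : fieldType) (n k : nat) (x : 'rV[F]_n)
    (A : 'M[F]_(k, n)) (p : {mpoly F[n]}) : {mpoly F[k]} :=
  p \mPo [tuple (x 0 j)%:MP + \sum_i A i j *: 'X_i | j < n].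

(** The relation [r] is abstract so that one induction serves both the degree bound ([leq]) and the
    homogeneous case ([eq_op]). *)
Lemma msupp_prod_rel (F : fieldType) (k : nat) (r : rel nat) (I : finType)
    (f : I -> {mpoly F[k]}) (d : I -> nat) :
  r 0%N 0%N -> (forall a b c d, r a b -> r c d -> r (a + c) (b + d))%N ->
  (forall i m, m \in msupp (f i) -> r (mdeg m) 1%N) ->
  forall m, m \in msupp (\prod_i f i ^+ d i) -> r (mdeg m) (\sum_i d i)%N.
Proof.
move=> r00 rD hf.
have hM a b p q : (forall m, m \in msupp p -> r (mdeg m) a) ->
    (forall m, m \in msupp q -> r (mdeg m) b) ->
    forall m : 'X_{1..k}, m \in msupp (p * q) -> r (mdeg m) (a + b)%N.
  move=> hp hq m /msuppM_le /allpairsP[[m1 m2] /= [h1 h2 ->]].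
  by rewrite mdegD; apply: rD; [apply: hp | apply: hq].
have h1 m : m \in msupp (1 : {mpoly F[k]}) -> r (mdeg m) 0%N.
  by rewrite msupp1 inE => /eqP ->; rewrite mdeg0.
apply: (big_ind2 (fun (p : {mpoly F[k]}) a =>
  forall m, m \in msupp p -> r (mdeg m) a)) => [//|p a q b|i _].
  exact: hM.
elim: (d i) => [|e IH]; first by rewrite expr0.
by rewrite exprS -add1n; apply: hM => //; apply: hf.
Qed.

Lemma msupp_comp_rel (F : fieldType) (n k : nat) (r : rel nat)
    (lq : n.-tuple {mpoly F[k]}) (p : {mpoly F[n]}) (m : 'X_{1..k}) :
  r 0%N 0%N -> (forall a b c d, r a b -> r c d -> r (a + c) (b + d))%N ->
  (forall i m, m \in msupp (tnth lq i) -> r (mdeg m) 1%N) ->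
  m \in msupp (p \mPo lq) ->
  exists2 m', m' \in msupp p & r (mdeg m) (mdeg m').
Proof.
move=> r00 rD hlq; rewrite mcoeff_msupp comp_mpolyE raddf_sum /=.
have [/hasP[m' m'p hm']|/hasPn hN] := boolP (has (fun m' : 'X_{1..n} =>
   m \in msupp (\prod_(i < n) tnth lq i ^+ m' i)) (msupp p)).
  by exists m' => //; rewrite [mdeg m']mdegE; apply: msupp_prod_rel hm'.
rewrite big_seq big1 ?eqxx // => m' /hN.
by rewrite mcoeffZ => /memN_msupp_eq0 ->; rewrite mulr0.
Qed.

Lemma msupp_linear_form (F : fieldType) (k : nat) (a : 'I_k -> F) m :
  m \in msupp (\sum_i a i *: 'X_i : {mpoly F[k]}) -> mdeg m = 1%N.
Proof.
rewrite mcoeff_msupp raddf_sum /=; apply: contraNeq => hm.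
rewrite big1 // => i _; rewrite mcoeffZ mcoeffX.
case: (U_(i)%MM =P m) => [E|_]; last by rewrite mulr0.
by move: hm; rewrite -E mdeg1 eqxx.
Qed.

Lemma msize_aff (F : fieldType) (n k : nat) (x : 'rV[F]_n)
    (A : 'M[F]_(k, n)) (p : {mpoly F[n]}) :
  (msize (aff_mpoly x A p) <= msize p)%N.
Proof.
rewrite msizeE; apply/bigmax_leqP_seq => m hm _.
have [|a b c d||m' m'p] := msupp_comp_rel (r := leq) _ _ _ hm => //.
- exact: leq_add.
- move=> i m0; rewrite tnth_mktuple => /msuppD_le; rewrite mem_cat.
  case/orP=> [|/msupp_linear_form ->//].
  by rewrite msuppC; case: ifP => // _; rewrite inE => /eqP ->; rewrite mdeg0.
- by move=> /leq_ltn_trans; apply; apply: msize_mdeg_lt.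
Qed.

(** With base point 0 the substituted forms are linear, so monomials keep their degree and the order
    of vanishing cannot drop. *)
Lemma aff0_low_degree (F : fieldType) (n k e : nat)
    (A : 'M[F]_(k, n)) (p : {mpoly F[n]}) :
  (forall m, (mdeg m < e)%N -> p@_m = 0) ->
  forall m, (mdeg m < e)%N -> (aff_mpoly 0 A p)@_m = 0.
Proof.
move=> hp m hm; apply/eqP; rewrite mcoeff_eq0; apply/negP => hs.
have [||i m0|m' m'p /eqP e'] := msupp_comp_rel (r := eq_op) _ _ _ hs => //.
- by move=> a b c d /eqP -> /eqP ->.
- rewrite tnth_mktuple mxE mpolyC0 add0r => /msupp_linear_form ->//.
- by move: m'p; rewrite mcoeff_msupp hp ?eqxx // -e'.
Qed.

Lemma aff_aff (F : fieldType) (n k l : nat) (x : 'rV[F]_n)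
    (A : 'M[F]_(k, n)) (y : 'rV[F]_k) (B : 'M[F]_(l, k)) (p : {mpoly F[n]}) :
  aff_mpoly y B (aff_mpoly x A p) = aff_mpoly (x + y *m A) (B *m A) p.
Proof.
rewrite /aff_mpoly (comp_mpolyEX p) [RHS]comp_mpolyEX raddf_sum /=.
apply: eq_bigr => m _; rewrite comp_mpolyZ; congr (_ *: _).
rewrite !comp_mpolyX rmorph_prod /=; apply: eq_bigr => j _.
rewrite rmorphXn; congr (_ ^+ _); rewrite !tnth_mktuple.
rewrite rmorphD /= comp_mpolyC raddf_sum /= !mxE mpolyCD -addrA; congr (_ + _).
rewrite (eq_bigr (fun i => (y 0 i * A i j)%:MP +
    \sum_t (B t i * A i j) *: 'X_t : {mpoly F[l]})) => [|i _]; last first.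
  rewrite comp_mpolyZ comp_mpolyXU -tnth_nth tnth_mktuple scalerDr.
  rewrite -mul_mpolyC -mpolyCM mulrC scaler_sumr; congr (_ + _).
  by apply: eq_bigr => t _; rewrite scalerA mulrC.
rewrite big_split /= raddf_sum /=; congr (_ + _).
rewrite exchange_big /=; apply: eq_bigr => t _.
by rewrite mxE scaler_suml.
Qed.

Lemma aff_id (F : fieldType) (n : nat) (p : {mpoly F[n]}) :
  aff_mpoly 0 1%:M p = p.
Proof.
rewrite /aff_mpoly -[RHS]comp_mpoly_id; congr (_ \mPo _).
apply: eq_from_tnth => j; rewrite !tnth_mktuple mxE mpolyC0 add0r.
rewrite (bigD1 j) //= mxE eqxx scale1r big1 ?addr0 // => i /negbTE ij.
by rewrite mxE ij scale0r.
Qed.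

(** The substitution sets the variables in [S] to constants and keeps the others. It serves both to
    restrict to a plane and to read off a coefficient along a line. *)
Lemma mcoeff_aff_freeze (F : fieldType) (N : nat) (S : {set 'I_N})
    (y : 'rV[F]_N) (A : 'M[F]_N) (p : {mpoly F[N]}) (g : 'X_{1..N}) :
  (forall j, j \notin S -> y 0 j = 0) ->
  (forall i j, A i j = ((i == j) && (j \notin S))%:R) ->
  (forall j, j \in S -> g j = 0%N) ->
  (aff_mpoly y A p)@_g =
    \sum_(m <- msupp p | [forall j, (j \notin S) ==> (m j == g j)])
      p@_m * \prod_(j in S) y 0 j ^+ m j.
Proof.
move=> hy hA hg; rewrite /aff_mpoly comp_mpolyE raddf_sum /= [RHS]big_mkcond.
apply: eq_bigr => m _; rewrite mcoeffZ.
pose m' := [multinom (if j \in S then 0%N else m j) | j < N].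
have -> : \prod_(i < N)
    tnth [tuple (y 0 j)%:MP + \sum_i A i j *: 'X_i | j < N] i ^+ m i
    = (\prod_(j in S) y 0 j ^+ m j) *: 'X_[m'] :> {mpoly F[N]}.
  rewrite -mul_mpolyC rmorph_prod /= [X in _ * X]mpolyXE_id.
  rewrite [X in X * _]big_mkcond /= -big_split /=.
  apply: eq_bigr => j _; rewrite tnth_mktuple mnmE.
  have [jS|jS] := boolP (j \in S).
    rewrite big1 ?addr0 ?mulr1 ?rmorphXn // => i _.
    by rewrite hA jS andbF scale0r.
  rewrite mul1r hy // mpolyC0 add0r (bigD1 j) //= hA eqxx jS scale1r.
  by rewrite big1 ?addr0 // => i /negbTE ij; rewrite hA ij scale0r.
rewrite mcoeffZ mcoeffX.
have -> : (m' == g) = [forall j, (j \notin S) ==> (m j == g j)].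
  apply/eqP/forallP => [<- j|h].
    by apply/implyP => jS; rewrite mnmE (negbTE jS).
  apply/mnmP => j; rewrite mnmE; case: ifPn => [/hg //|jS].
  by apply/eqP; have:= h j; rewrite jS.
by case: ifP; rewrite ?mulr1 ?mulr0 ?mulr0.
Qed.

(** * A polynomial vanishing on all planes *)

(* [g] is sought among the polynomials of degree less than [E] in each variable,
   a space of dimension [E ^ n]; their total degree is at most [n * E.-1], so the
   restriction to a [k]-plane has at most [(n * E.-1).+1 ^ k] coefficients. *)
Lemma exists_vanishing_mpoly (F : fieldType) (n k E : nat) (I : finType)
    (x0 : I -> 'rV[F]_n) (B : I -> 'M[F]_(k, n)) :
  (#|I| * (n * E.-1).+1 ^ k < E ^ n)%N ->
  exists g : {mpoly F[n]}, [/\ g != 0, (msize g <= (n * E.-1).+1)%N &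
    forall i, aff_mpoly (x0 i) (B i) g = 0].
Proof.
set D := (n * E.-1)%N => hcard.
pose T : finType := {ffun 'I_n -> 'I_E}.
pose K : finType := (I * {ffun 'I_k -> 'I_D.+1})%type.
pose mon a b (f : {ffun 'I_a -> 'I_b}) := [multinom (f i : nat) | i < a].
have mon_inj a b : injective (@mon a b).
  move=> f1 f2 /mnmP h; apply/ffunP => i; apply: val_inj.
  by have := h i; rewrite !mnmE.
(* Rows are the monomials of [g], columns the coefficients of its restrictions; with more rows than
   columns the left kernel is nonzero. *)
pose M := \matrix_(a < #|T|, b < #|K|)
  (aff_mpoly (x0 (enum_val b).1) (B (enum_val b).1)
     'X_[mon _ _ (enum_val a)])@_(mon _ _ (enum_val b).2).
have : kermx M != 0.
  rewrite -mxrank_eq0 mxrank_ker -lt0n subn_gt0.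
  apply: leq_ltn_trans (rank_leq_col M) _.
  by rewrite card_prod !card_ffun !card_ord.
case/rowV0Pn => u /sub_kermxP uM u0.
pose g : {mpoly F[n]} := \sum_a u 0 a *: 'X_[mon _ _ (enum_val a)].
have gE a : g@_(mon _ _ (enum_val a)) = u 0 a.
  rewrite raddf_sum /= (bigD1 a) //= mcoeffZ mcoeffX eqxx mulr1 big1 ?addr0 //.
  move=> b ba; rewrite mcoeffZ mcoeffX.
  by rewrite (inj_eq (@mon_inj _ _)) (inj_eq enum_val_inj) (negbTE ba) mulr0.
have szg : (msize g <= D.+1)%N.
  apply: leq_trans (msize_sum _ _ _) _; apply/bigmax_leqP => a _.
  apply: leq_trans (msizeZ_le _ _) _; rewrite msizeX ltnS mdegE.
  rewrite /D -[n in (n * _)%N]card_ord -sum_nat_const; apply: leq_sum => i _.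
  by rewrite mnmE -ltnS; case: (_ i) => c /= hc; rewrite (ltn_predK hc).
exists g; split => // [|i].
  apply: contraNneq u0 => g0; apply/eqP/rowP => a.
  by rewrite -gE g0 mcoeff0 mxE.
apply/mpolyP => m; rewrite mcoeff0.
(* A monomial with an exponent above [D] exceeds the degree of the restriction, so only those
   indexed by [K] impose conditions. *)
have [/forallP hm|] := boolP [forall j, (m j < D.+1)%N]; last first.
  rewrite negb_forall => /existsP[j]; rewrite -leqNgt => hj.
  apply: memN_msupp_eq0; apply: msize_mdeg_ge.
  apply: leq_trans (msize_aff _ _ _) _; apply: leq_trans szg _.
  by apply: leq_trans hj _; rewrite mdegE (bigD1 j) //= leq_addr.
pose f : {ffun 'I_k -> 'I_D.+1} := [ffun j => Ordinal (hm j)].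
have -> : m = mon _ _ f by apply/mnmP => j; rewrite mnmE ffunE.
have /rowP/(_ (enum_rank ((i, f) : K))) := uM; rewrite !mxE => <-.
have -> : aff_mpoly (x0 i) (B i) g =
    \sum_a u 0 a *: aff_mpoly (x0 i) (B i) 'X_[mon _ _ (enum_val a)].
  rewrite /aff_mpoly raddf_sum /=; apply: eq_bigr => a _.
  by rewrite comp_mpolyZ.
rewrite raddf_sum; apply: eq_bigr => a _.
by rewrite /= mcoeffZ mxE enum_rankK.
Qed.

(** * Raising the order of vanishing *)

Lemma sum_msupp_pred1 (F : fieldType) (N : nat) (p : {mpoly F[N]}) b :
  \sum_(d <- msupp p | d == b) p@_d = p@_b.
Proof.
have [bp|/[dup] bp /memN_msupp_eq0 ->] := boolP (b \in msupp p).
  by rewrite -big_filter (filter_pred1_uniq (msupp_uniq p) bp) big_seq1.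
by rewrite big_seq_cond big1 // => d /andP[dp /eqP db]; rewrite -db dp in bp.
Qed.

Lemma no_rich_configuration (F : fieldType) (n k m E : nat) (I : finType)
    (x0 : I -> 'rV[F]_n) (B : I -> 'M[F]_(k, n)) (S : 'rV[F]_n -> Prop) :
  (#|I| * (n * E.-1).+1 ^ k < E ^ n)%N ->
  (forall x, S x -> exists i (y : 'rV_k) (V : 'M_(m, n)),
    [/\ x = x0 i + y *m B i, row_full (col_mx V (B i)) &
        forall j, exists s : seq F, [/\ uniq s, (n * E.-1 < size s)%N &
          forall a, a \in s -> S (x + a *: row j V)]]) ->
  forall x, ~ S x.
Proof.
move=> hcard hS; have [g [g0 szg gB]] := exists_vanishing_mpoly x0 B hcard.
(* Vanishing to every order at one point makes the expansion there zero; translating back gives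
   [g = 0]. *)
suff van e x : S x -> forall b, (mdeg b < e)%N -> (aff_mpoly x 1%:M g)@_b = 0.
  move=> x Sx; case/eqP: g0; rewrite -[g]aff_id.
  have -> : aff_mpoly 0 1%:M g = aff_mpoly (- x) 1%:M (aff_mpoly x 1%:M g).
    by rewrite aff_aff !mulmx1 subrr.
  suff -> : aff_mpoly x 1%:M g = 0 by rewrite /aff_mpoly raddf0.
  by apply/mpolyP => b; rewrite mcoeff0 (van (mdeg b).+1 x).
elim: e x => [//|e IH] x Sx.
have [i [y [V [xE full rich]]]] := hS x Sx.
set A := col_mx V (B i) in full; pose q := aff_mpoly x A g.
have szq : (msize q <= (n * E.-1).+1)%N.
  exact: leq_trans (msize_aff _ _ _) szg.
(* [q] is [g] in coordinates along the rows of [V] and [B i]; a left inverse [C] of [A] leads back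
   without lowering the order. *)
suff qlow b : (mdeg b < e.+1)%N -> q@_b = 0.
  have [C CA] := row_fullP full.
  have -> : aff_mpoly x 1%:M g = aff_mpoly 0 C q.
    by rewrite aff_aff mul0mx addr0 CA.
  exact: aff0_low_degree.
rewrite ltnS => hb.
(* If [b] involves plane variables only, setting the line variables to 0 restricts [g] to the plane,
   where it vanishes. *)
have [/forallP b0|] := boolP [forall j, b (lshift k j) == 0%N].
  pose Z : 'M[F]_(m + k) := block_mx 0 0 0 1%:M.
  have Z0 : aff_mpoly 0 Z q = 0.
    rewrite aff_aff mul0mx addr0 /A /Z mul_block_col !mul0mx !add0r mul1mx.
    pose U : 'M[F]_(m + k, k) := col_mx 0 1%:M.
    have -> : col_mx 0 (B i) = U *m B i.
      by rewrite /U mul_col_mx mul0mx mul1mx.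
    have -> : aff_mpoly x (U *m B i) g
            = aff_mpoly y U (aff_mpoly (x0 i) (B i) g).
      by rewrite aff_aff -xE.
    by rewrite gB /aff_mpoly raddf0.
  have := @mcoeff_aff_freeze F _ [set lshift k j | j : 'I_m] 0 Z q b.
  rewrite Z0 mcoeff0 => -> //.
  - rewrite (eq_bigr (fun d : 'X_{1..m + k} => if d == b then q@_d else 0)).
      rewrite -big_mkcondr (eq_bigl (pred1 b)) ?sum_msupp_pred1 // => d /=.
      rewrite andb_idl // => /eqP ->; apply/forallP => t; exact/implyP.
    move=> d /forallP hd; case: eqVneq => [->|db].
      rewrite big1 ?mulr1 // => _ /imsetP[j _ ->].
      by rewrite (eqP (b0 j)) expr0.
    have [j dj] : exists j, d (lshift k j) != 0%N.
      apply/existsP; apply: contraNT db; rewrite negb_exists => /forallP d0.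
      apply/eqP/mnmP => t.
      have [/imsetP[j _ ->]|tS] := boolP (t \in [set lshift k j | j : 'I_m]).
        by rewrite (eqP (b0 j)); apply/eqP; have := d0 j; rewrite negbK.
      by apply/eqP; have := hd t; rewrite tS.
    rewrite (bigD1 (lshift k j)) ?imset_f //= mxE.
    by rewrite expr0n (negbTE dj) mul0r mulr0.
  - by move=> j _; rewrite mxE.
  - move=> a c; rewrite /Z -[a]splitK -[c]splitK.
    case: (split a) => a'; case: (split c) => c' /=.
    + by rewrite block_mxEul mxE imset_f // andbF.
    + by rewrite block_mxEur mxE eq_lrshift.
    + by rewrite block_mxEdl mxE imset_f // andbF.
    rewrite block_mxEdr mxE eq_rshift; case: eqP => //= _.
    by case: imsetP => // -[j _ /eqP]; rewrite eq_rlshift.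
  - by move=> _ /imsetP[j _ ->]; apply/eqP.
rewrite negb_forall => /existsP[j bj]; set i0 := lshift k j in bj.
have [s [us szs hs]] := rich j.
(* Deleting the nonzero exponent at [i0] brings the degree below [e], within reach of the induction
   hypothesis. *)
pose c := [multinom (if t == i0 then 0%N else b t) | t < m + k].
have cb : (mdeg c < e)%N.
  apply: leq_trans hb; rewrite !mdegE.
  rewrite (bigD1 i0) //= [X in (_ < X)%N](bigD1 i0) //= mnmE eqxx add0n.
  rewrite (eq_bigr b) => [|t /negbTE ti]; last by rewrite mnmE ti.
  by rewrite -[X in (X < _)%N]add0n ltn_add2r lt0n.
pose P (d : 'X_{1..m + k}) := [forall t, (t \notin [set i0]) ==> (d t == c t)].
(* The coefficient in [q] of the monomial [c] in the other variables, as a polynomial in the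
   variable [i0]. *)
pose h : {poly F} := \sum_(d <- msupp q | P d) q@_d *: 'X^(d i0).
have h0 : h = 0.
  apply: (roots_geq_poly_eq0 (rs := s)) => //; last first.
    apply: leq_trans szs; apply: leq_trans (size_sum _ _ _) _.
    apply/bigmax_leqP_seq => d dq _; apply: leq_trans (size_scale_leq _ _) _.
    rewrite size_polyXn; apply: leq_trans szq.
    apply: leq_ltn_trans (msize_mdeg_lt dq).
    by rewrite mdegE (bigD1 i0) //= leq_addr.
  apply/allP => a /hs Sa; apply/eqP; rewrite horner_sum.
  (* Evaluating [h] at [a] moves the base point to another point of [S], where the induction
     hypothesis holds too. *)
  pose Z : 'M[F]_(m + k) := \matrix_(t, r) ((t == r) && (r \notin [set i0]))%:R.
  have := @mcoeff_aff_freeze F _ [set i0] (a *: delta_mx 0 i0) Z q c.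
  have -> : aff_mpoly (a *: delta_mx 0 i0) Z q =
      aff_mpoly 0 (Z *m A) (aff_mpoly (x + a *: row j V) 1%:M g).
    have dA : (a *: delta_mx 0 i0) *m A = a *: row j V.
      by rewrite -scalemxAl -rowE /A /i0 rowKu.
    by rewrite /q aff_aff [RHS]aff_aff mul0mx addr0 mulmx1 dA.
  rewrite (aff0_low_degree (e := e)) //; last exact: IH.
  move=> H; rewrite [RHS]H.
  - apply: eq_bigr => d _; rewrite hornerZ hornerXn big_set1 !mxE !eqxx.
    by rewrite mulr1.
  - by move=> t; rewrite inE => ti; rewrite !mxE (negbTE ti) mulr0.
  - by move=> t r; rewrite mxE.
  - by move=> t; rewrite inE => /eqP ->; rewrite mnmE eqxx.
have := congr1 (fun p : {poly F} => p`_(b i0)) h0; rewrite coef0 coef_sum => <-.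
have Pb d : P d && (b i0 == d i0) = (d == b).
  apply/andP/eqP => [[/forallP hP /eqP bd]|->]; last first.
    split=> //; apply/forallP => t; rewrite inE.
    by apply/implyP => /negbTE ti; rewrite mnmE ti.
  apply/mnmP => t; have [-> //|ti] := eqVneq t i0.
  by have := hP t; rewrite inE ti mnmE (negbTE ti) => /eqP.
rewrite (eq_bigr (fun d : 'X_{1..m + k} =>
    if b i0 == d i0 then q@_d else 0)); last first.
  by move=> d _; rewrite coefZ coefXn; case: eqP; rewrite ?mulr1 ?mulr0.
rewrite -big_mkcondr /= (eq_bigl _ _ Pb).
by rewrite sum_msupp_pred1.
Qed.

End AffineSubstitution.

From mathcomp Require Import finmap.
From mathcomp Require Import all_classical all_reals all_analysis.

Local Open Scope classical_set_scope.
Local Open Scope ring_scope.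

(** * Counting points by removing lines *)

Lemma card_joints_le (F : fieldType) (n k m E : nat) (I : finType)
    (x0 : I -> 'rV[F]_n) (B : I -> 'M[F]_(k, n))
    (Ls : {fset (set 'rV[F]_n)}) (S : {fset 'rV[F]_n}) :
  (#|I| * (n * E.-1).+1 ^ k < E ^ n)%N ->
  (forall x, x \in S -> exists i (y : 'rV_k) (V : 'M[F]_(m, n)),
    [/\ x = x0 i + y *m B i, row_full (col_mx V (B i)) &
        forall j, exists l, [/\ l \in Ls, l x &
          forall z, l z -> exists a, z = x + a *: row j V]]) ->
  (#|` S| <= n * E.-1 * #|` Ls|)%N.
Proof.
move=> hcard; have [c Lc] := ubnP #|` Ls|.
elim: c Ls S Lc => // c IH Ls S Lc hS.
pose on (l : set 'rV[F]_n) := [fset x in S | `[< l x >]]%fset.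
have [[l lL poor]|rich] :=
    pselect (exists2 l, l \in Ls & (#|` on l| <= n * E.-1)%N).
  rewrite (cardfsD1 l) lL mulnDr muln1 -(cardfsID (on l) S) leq_add //.
    by apply: leq_trans poor; apply: fsubset_leq_card; apply: fsubsetIr.
  apply: IH => [|x].
    by move: Lc; rewrite (cardfsD1 l Ls) lL.
  (* A remaining point is off [l], so it keeps all its lines. *)
  rewrite !inE => /andP[xl xS]; have [i [y [V [xE full hl]]]] := hS x xS.
  exists i, y, V; split=> // j; have [l' [l'L l'x hl']] := hl j.
  exists l'; split=> //; rewrite !inE l'L andbT.
  by apply: contraNneq xl => <-; rewrite xS; apply/asboolP.
have [->|[x xS]] := fset_0Vmem S; first by rewrite cardfs0.
exfalso; move: x xS.
apply: (no_rich_configuration (x0 := x0) (B := B) (m := m) hcard) => x xS.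
have [i [y [V [xE full hl]]]] := hS x xS.
exists i, y, V; split=> // j; have [l [lL lx hl']] := hl j.
(* Parameters turn the points of [S] on [l] into distinct scalars; off [l] the value 0 is a
   default. *)
have [a aE] : {a : 'rV[F]_n -> F & forall z, l z -> z = x + a z *: row j V}.
  apply: (@choice _ _ (fun z b => l z -> z = x + b *: row j V)) => z.
  have [/hl'[b ->]|nlz] := pselect (l z); first by exists b.
  by exists 0 => /nlz.
have onl z : z \in on l -> z \in S /\ l z.
  by rewrite !inE => /andP[zS /asboolP].
exists [seq a z | z <- on l]; split.
- rewrite map_inj_in_uniq ?fset_uniq // => z t /onl[_ lz] /onl[_ lt] azt.
  by rewrite (aE z lz) (aE t lt) azt.
- rewrite size_map ltnNge; apply/negP => poor; apply: rich.
  by exists l.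
- by move=> b /mapP[z /onl[zS lz] ->]; rewrite -aE.
Qed.

(** * Coordinates for planes and multijoints *)

Lemma plane_param (F : fieldType) (n k : nat) (P : set 'rV[F]_n) :
  is_plane k P -> exists p : 'rV[F]_n * 'M[F]_(k, n),
    forall z, P z <-> exists y, z = p.1 + y *m p.2.
Proof.
case=> W <- [x0 ->]; pose B := \matrix_(i < \dim W) (vbasis W)`_i.
have BE y : y *m B = \sum_i y 0 i *: (vbasis W)`_i.
  by rewrite mulmx_sum_row; apply: eq_bigr => i _; rewrite rowK.
exists (x0, B) => z; split=> /= [[w wW <-]|[y ->]].
  exists (\row_i coord (vbasis W) i w); rewrite BE; congr (_ + _).
  by rewrite [LHS](coord_vbasis wW); apply: eq_bigr => i _; rewrite mxE.
exists (y *m B) => //=; rewrite BE; apply: memv_suml => i _.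
by apply: memvZ; apply: vbasis_mem; apply: mem_nth; rewrite size_tuple.
Qed.

Lemma multijoint_coordinates (F : fieldType) (n k m : nat)
    (Ls : 'I_m -> {fset (set 'rV[F]_n)}) (Ps : {fset (set 'rV[F]_n)})
    (x0 : Ps -> 'rV[F]_n) (B : Ps -> 'M[F]_(k, n)) (x : 'rV[F]_n) :
  (forall (i : Ps) z, val i z <-> exists y, z = x0 i + y *m B i) ->
  is_multijoint Ls Ps x ->
  exists i (y : 'rV_k) (V : 'M[F]_(m, n)),
    [/\ x = x0 i + y *m B i, row_full (col_mx V (B i)) &
        forall j, exists l, [/\ l \in Ls j, l x &
          forall z, l z -> exists a, z = x + a *: row j V]].
Proof.
move=> hB [l [P [hl [PPs Px] [v [W [hv PW vW]]]]]].
pose i : Ps := [` PPs]%fset; have [y xE] := (hB i x).1 Px.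
pose V : 'M[F]_(m, n) := \matrix_j v j.
exists i, y, V; split=> //.
- rewrite -sub1mx; apply/row_subP => t; set u := row t _.
  have : u \in (<<[seq v j | j <- enum 'I_m]>> + W)%VS by rewrite vW memvf.
  case/memv_addP => u1 u1v [w wW ->].
  (* [W] and [B i] describe the same plane independently: a vector of [W] is a difference of two
     points of the plane, hence in the row space of [B i]. *)
  have [x1 PE] := PW.
  have [y1 y1E] : exists y, x1 = x0 i + y *m B i.
    by apply/(hB i); rewrite /= PE; exists 0; rewrite /= ?mem0v ?addr0.
  have [y2 y2E] : exists y, x1 + w = x0 i + y *m B i.
    by apply/(hB i); rewrite /= PE; exists w.
  have wE : w = (y2 - y1) *m B i.
    have -> : w = x1 + w - x1 by rewrite addrAC subrr add0r.
    by rewrite y2E y1E mulmxBl opprD addrACA subrr add0r.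
  pose X := [tuple v j | j < m].
  apply/submxP; exists (row_mx (\row_j coord X j u1) (y2 - y1)).
  rewrite mul_row_col -wE; congr (_ + _).
  rewrite [LHS](@coord_span _ _ _ X u1) // mulmx_sum_row.
  by apply: eq_bigr => j _; rewrite mxE rowK -tnth_nth tnth_mktuple.
- move=> j; have [lL lx] := hl j; exists (l j); split=> // z lz.
  have [_ [x1 lE]] := hv j; rewrite lE in lx lz.
  case: lx => w1 /= /vlineP[a1 ->] <-; case: lz => w2 /= /vlineP[a2 ->] <-.
  exists (a2 - a1); rewrite rowK scalerBl -addrA; congr (_ + _).
  by rewrite addrC subrK.
Qed.

(** * Choice of the degree and the final bound *)

Lemma card_bigfsetU_le (T : choiceType) (m : nat) (A : 'I_m -> {fset T}) :
  (#|` \big[fsetU/fset0]_i A i| <= m * \max_i #|` A i|)%N.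
Proof.
apply: (@leq_trans (\sum_i #|` A i|)); last first.
  rewrite -[m in (m * _)%N]card_ord -sum_nat_const; apply: leq_sum => i _.
  exact: leq_bigmax.
apply: (big_ind2 (fun (X : {fset T}) a => #|` X| <= a)%N) => //.
by move=> X a Y b Xa Yb; rewrite cardfsU (leq_trans (leq_subr _ _)) ?leq_add.
Qed.

(** Take [E.-1] to be the integer part of [n^n * p^(1/(n-k))]. As [n^k <= n^(n(n-k))], this gives
    [n^k * p < E^(n-k)], and [n * E.-1 + 1 <= n * E] does the rest. *)
Lemma degree_bound (R : realType) (n k p : nat) : (k < n)%N ->
  exists E, (p * (n * E.-1).+1 ^ k < E ^ n)%N /\
    E.-1%:R <= (n ^ n)%:R * p%:R `^ ((n - k)%:R)^-1 :> R.
Proof.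
move=> kn; set m := (n - k)%N; have m0 : (0 < m)%N by rewrite subn_gt0.
set r : R := p%:R `^ _; have r0 : 0 <= r by apply: powR_ge0.
have rm : r ^+ m = p%:R.
  rewrite -powR_mulrn // -powRrM mulVf ?powRr1 //.
  by rewrite pnatr_eq0 -lt0n.
set b := (n ^ n)%:R * r; have b0 : 0 <= b by rewrite mulr_ge0.
exists (Num.truncn b).+1 => /=; split; last by rewrite truncn_le.
set t := Num.truncn b; have n0 : (0 < n)%N by apply: leq_ltn_trans kn.
have tm : (n ^ k * p < t.+1 ^ m)%N.
  rewrite -(ltr_nat R) natrX.
  apply: (@le_lt_trans _ _ (b ^+ m)); last first.
    by rewrite ltrXn2r ?ler0n // -?lt0n // truncnS_gt.
  rewrite exprMn rm -natrX -natrM ler_nat leq_mul2r; apply/orP; right.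
  rewrite -expnM leq_pexp2l // (leq_trans (ltnW kn)) // leq_pmulr //.
have tn : ((n * t).+1 <= n * t.+1)%N by rewrite mulnS -add1n leq_add2r.
apply: (@leq_ltn_trans (n ^ k * p * t.+1 ^ k)).
  rewrite [(n ^ k * p)%N]mulnC -mulnA -expnMn leq_mul2l; apply/orP; right.
  by have [->|k0] := posnP k; rewrite ?expn0 ?leq_exp2r.
have -> : (t.+1 ^ n = t.+1 ^ m * t.+1 ^ k)%N by rewrite -expnD subnK // ltnW.
by rewrite ltn_pmul2r ?expn_gt0.
Qed.

Theorem mainTheorem1 (R : realType) (n : nat) (hn : (3 <= n)%N) :
  exists C : R,
    forall (F : fieldType) (k : nat), (2 <= k)%N -> (k <= n - 1)%N ->
    forall (Ls : 'I_(n - k) -> {fset (set 'rV[F]_n)})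
           (Ps : {fset (set 'rV[F]_n)}),
      (forall i A, A \in Ls i -> is_line A) ->
      (forall A, A \in Ps -> is_plane k A) ->
      let J := multijoints Ls Ps in
      let L := (\max_(i < n - k) #|` Ls i|)%N in
      let d := (n - k + 1)%N in
      finite_set J /\
      (#|` fset_set J|)%:R <= C * L%:R * (#|` Ps|)%:R `^ ((d - 1)%:R)^-1.
Proof.
(* One factor [n] comes from the degree [n * E.-1], one from merging [n - k <= n] families of lines,
   and [n ^ n] from [degree_bound]. *)
exists (n * n * n ^ n)%:R => F k _ kn Ls Ps _ hP J L d.
have {}kn : (k < n)%N.
  by move: kn; rewrite leq_subRL 1?addnC ?addn1 // ltnW // ltnW.
have [E [hE Er]] := degree_bound R #|` Ps| kn.
have [p pE] := choice (fun i : Ps => plane_param (hP _ (valP i))).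
pose N := (n * E.-1 * ((n - k) * L))%N.
(* A uniform bound on finite subsets of [J] yields both its finiteness and its cardinality. *)
have bound (S : {fset 'rV[F]_n}) : [set` S] `<=` J -> (#|` S| <= N)%N.
  move=> SJ; pose LL := \big[fsetU/fset0]_i Ls i.
  apply: (@leq_trans (n * E.-1 * #|` LL|)); last first.
    by rewrite leq_mul2l card_bigfsetU_le orbT.
  have hE' := hE; rewrite cardfE in hE'.
  apply: (card_joints_le (x0 := fst \o p) (B := snd \o p) hE') => x /SJ xJ.
  have [i [y [V [xE full hl]]]] :=
    multijoint_coordinates (x0 := fst \o p) (B := snd \o p) pE xJ.
  exists i, y, V; split=> // j; have [l [lL lx hl']] := hl j.
  by exists l; split=> //; rewrite /LL (bigD1 j) //= inE lL.
have Jfin : finite_set J.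
  apply: contrapT => /(infinite_set_fset N.+1)[S SJ NS].
  by have := bound _ SJ; rewrite leqNgt NS.
split=> //; rewrite /d addnK.
have : (#|` fset_set J| <= N)%N.
  by apply: bound => x /=; rewrite in_fset_set // inE.
rewrite -(ler_nat R) => /le_trans; apply.
set r := _ `^ _ in Er *.
have -> : (n * n * n ^ n)%:R * L%:R * r = (n * (n * L))%:R * ((n ^ n)%:R * r).
  by rewrite !natrM -!mulrA (mulrCA (n ^ n)%:R).
apply: (@le_trans _ _ ((n * (n * L))%:R * E.-1%:R)); last first.
  by rewrite ler_wpM2l.
rewrite -natrM ler_nat /N mulnAC leq_mul2r leq_mul2l leq_mul2r leq_subr.
by rewrite !orbT.
Qed.
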